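(* Let $Z$ be a completely regular space with the $B$-property and let $X\subseteq Z$ be a Lindelöf subspace of $Z$. Then there exist a separable metrizable space $H$ and a continuous bijection $\varphi:X\to H$.
   Context: Completely regular spaces are understood to be Hausdorff (Tychonoff), i.e. embeddable in some power $\mathbb R^S$. A function $f:X\times Y\to\mathbb R$ on a product of topological spaces is separately continuous if it is continuous in each variable when the other is fixed. A function $f:X\to\mathbb R$ on a topological space is of the first Baire class if there is a sequence of continuous functions $f_n:X\to\mathbb R$ with $f(x)=\lim_{n\to\infty}f_n(x)$ for every $x\in X$. A topological space $Z$ has the $B$-property if for every topological space $Y$ each separately continuous function $f:Z\times Y\to\mathbb R$ is of the first Baire class (with respect to the product topology on $Z\times Y$). *)

(* Defs.v *)
From HB Require Import structures.
From mathcomp Require Import all_boot all_order all_algebra.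
From mathcomp Require Import all_classical reals topology normedtype.

Set Implicit Arguments.
Unset Strict Implicit.
Unset Printing Implicit Defensive.

Import Order.TTheory GRing.Theory Num.Theory.
Import numFieldNormedType.Exports.

Local Open Scope classical_set_scope.
Local Open Scope ring_scope.

(* [completely_regular_space] does not include the Hausdorff axiom. *)
Definition tychonoff_space (T : topologicalType) : Prop :=
  completely_regular_space T /\ hausdorff_space T.

(* [{ptws S -> R}] is the power of [R] with exponent [S], with the product
   topology. *)
Lemma tychonoff_space_embedding (R : realType) (T : topologicalType) :
  tychonoff_space T <->
  exists (S : Type) (e : T -> {ptws S -> R}),
    injective e /\ @open T = @open (initial_topology e).
Proof.
split=> [[crT hT]|[S [e [inj_e openE]]]].
  pose S := set_type [set f : T -> R | continuous f].
  pose f_ (i : S) : T -> R := set_val i.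
  have ctsf i : continuous (f_ i) := set_valP i.
  have sepf : separate_points_from_closed f_.
    move=> B x clB nBx.
    have /(@uniform_separatorP _ R)[f [ctf _ f0 f1]] := crT _ _ clB nBx.
    exists (SigSub (mem_set (ctf : [set f : T -> R | continuous f] f))).
    rewrite /f_ set_valE /= => /(closureS f1).
    have -> : f x = 0 by apply: f0; exists x.
    have /closure_id <- : closed [set 1 : R].
      exact: accessible_closed_set1 (hausdorff_accessible (@Rhausdorff R)) 1.
    by move/esym/eqP; rewrite oner_eq0.
  have injf := join_product_inj sepf (hausdorff_accessible hT).
  exists S, (join_product f_); split; first by move=> x y; apply: injf; rewrite inE.
  exact: join_product_initial.
pose W : uniformType := initial_topology e.
have nbhsE (x : T) : @nbhs T T x = @nbhs W W x.
  by rewrite predeqE => A; rewrite 2!nbhsE /open_nbhs /= openE.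
split.
  move=> x B clB nBx.
  have clB' : @closed W B by move: clB; rewrite -openC openE -openC.
  have [uT [E [entE ABE sub]]] := @point_uniform_separator R W x B clB' nBx.
  by exists uT, E; split => // z; rewrite nbhsE; exact: sub.
move=> x y clxy; apply: inj_e; apply: funext => s.
apply: (@Rhausdorff R) => A B Ax By.
have cts z : {for z, continuous (fun t : T => e t s)}.
  move=> U Us; rewrite nbhsE.
  have Us' : @nbhs {ptws S -> R} {ptws S -> R} (e z) [set g | U (g s)].
    have /cvg_sup/(_ s) h : nbhs (e z) --> (e z : {ptws S -> R}) by [].
    apply: h.
    exact: (@initial_continuous _ _ (fun g : {ptws S -> R} => g s) (e z) U Us).
  exact: (@initial_continuous _ _ e z _ Us').
have [t [At Bt]] := clxy _ _ (cts x _ Ax) (cts y _ By).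
by exists (e t s).
Qed.

Definition separately_continuous (X Y W : topologicalType) (f : X * Y -> W) :=
  (forall x, continuous (fun y => f (x, y))) /\
  (forall y, continuous (fun x => f (x, y))).

Definition first_Baire_class (R : realType) (T : topologicalType)
    (f : T -> R) : Prop :=
  exists f_ : nat -> T -> R,
    (forall n, continuous (f_ n)) /\
    (forall x, f_ n x @[n --> \oo] --> f x).

Definition B_property (R : realType) (Z : topologicalType) : Prop :=
  forall (Y : topologicalType) (f : Z * Y -> R),
    separately_continuous f -> first_Baire_class f.

Definition lindelof_space (T : topologicalType) : Prop :=
  forall C : set (set T), C `<=` open -> \bigcup_(U in C) U = setT ->
    exists D : set (set T),
      [/\ D `<=` C, countable D & \bigcup_(U in D) U = setT].

Definition separable_space (T : topologicalType) : Prop :=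
  exists2 D : set T, countable D & dense D.

Definition metrizable_space (R : realType) (T : topologicalType) : Prop :=
  exists (M : metricType R) (h : T -> M) (g : M -> T),
    [/\ cancel h g, cancel g h, continuous h & continuous g].

(* Main.v *)
Require Import Defs.
From HB Require Import structures.
From mathcomp Require Import all_boot all_order all_algebra.
From mathcomp Require Import lra.
From mathcomp Require Import all_classical reals topology normedtype.
Import Order.TTheory GRing.Theory Num.Theory.
Import numFieldNormedType.Exports.
Local Open Scope classical_set_scope.
Local Open Scope ring_scope.

(** The B-property is applied to the evaluation map (z, y) |-> y z on the
    product of Z with C_p(Z), the continuous real functions on Z with the
    topology of pointwise convergence.  Evaluation is separately continuous, so
    it is the pointwise limit of continuous functions f_n.  Countably many
    sections f_n(., b) already separate the points of X; they are found by a
    closing-off argument.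

    A basic neighbourhood in C_p(Z) restrains finitely many points of Z.  Since X
    is Lindelöf, for fixed b and n the dependence of f_n(x, y) on y near b, for
    all x in X together, is controlled by a countable set of points of Z
    ([countable_support]).  On the other hand, a finite set of points needs only
    countably many functions to approximate all of C(Z) on it
    ([countable_dense_on_finite]).  Alternating the two constructions
    ([countable_closure]) gives a countable A in Z and a countable B in C_p(Z)
    such that B approximates C(Z) on every finite subset of A, and such that the
    behaviour of f_n near each b in B is controlled by points of A.

    Let x and x' be distinct points of X, and choose y continuous with y x and
    y x' distinct.  Then f_n(x, y) and f_n(x', y) differ for some n, and they
    still differ when y is moved within a basic neighbourhood that restrains a
    finite set K.  Take b in B close to y on the part of K inside A, and glue: a
    Tychonoff space carries a continuous y' that equals b on finitely many points
    of A and y on the part of K outside A ([tychonoff_glue]).  As y' is close to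
    y on K, the values f_n(x, y') and f_n(x', y') are far apart; as y' equals b on
    the controlling points, they are close to f_n(x, b) and f_n(x', b).  So
    f_n(., b) separates x from x' ([first_Baire_separating_family]).

    Finally, a sequence of continuous functions that separates points defines a
    metric whose topology is coarser than that of X, and a metric continuous
    image of a Lindelöf space is separable ([lindelof_condensation]). *)

(** * Countable sets *)

Lemma countable_setU (T : Type) (A B : set T) :
  countable A -> countable B -> countable (A `|` B).
Proof.
move=> cA cB; have -> : A `|` B = \bigcup_(b in [set: bool]) if b then A else B.
  rewrite eqEsubset; split=> x; first by case=> ?; [exists true|exists false].
  by case=> -[] _ ?; [left|right].
by apply: bigcup_countable => [|[] _]; first exact: countableP.
Qed.

(** Iterating A |-> A + (the union of c F over finite F in A) countably often
    suffices, because c has finite arguments: a finite subset of the union of an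
    increasing sequence already lies in one of its terms. *)
Lemma countable_closure (T : choiceType) (c : set T -> set T) :
  (forall F, finite_set F -> countable (c F)) ->
  exists2 A, countable A & forall F, finite_set F -> F `<=` A -> c F `<=` A.
Proof.
move=> cc.
pose step A := A `|` \bigcup_(F in [set F | F `<=` A /\ finite_set F]) c F.
pose A_ n := iter n step set0.
have cA n : countable (A_ n).
  elim: n => [|n IHn]; first exact: countable0.
  apply: countable_setU => //; apply: bigcup_countable.
    exact: countable_finite_subset.
  by move=> F [_ /cc].
have homoA m n : (m <= n)%N -> A_ m `<=` A_ n.
  elim: n => [|n IHn]; first by rewrite leqn0 => /eqP ->.
  by rewrite leq_eqVlt => /orP[/eqP -> //|/IHn mn] x /mn; left.
exists (\bigcup_n A_ n); first by apply: bigcup_countable.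
move=> F finF FA.
have [n Fn] : exists n, F `<=` A_ n.
  have /finite_seqP[s Fs] := finF; move: FA; rewrite {}Fs {F finF}.
  elim: s => [|a s IHs] sA; first by exists 0%N.
  have [|n sn] := IHs; first by move=> x xs; apply: sA; rewrite /= inE xs orbT.
  have [|m _ am] := sA a; first by rewrite /= inE eqxx.
  exists (maxn m n) => x /=; rewrite inE => /orP[/eqP ->|xs].
    exact: homoA (leq_maxl _ _) _ am.
  exact: homoA (leq_maxr _ _) _ (sn _ xs).
by move=> x cFx; exists n.+1 => //; right; exists F.
Qed.

(** The restrictions of P to F form a subspace of a finite power of R, hence are
    separable.  Induction on F: the members of P are sorted by a rational interval
    that contains their value at the new point, and each class is approximated on
    the remaining points. *)
Lemma countable_dense_on_finite {R : realType} {T : choiceType}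
    (P : set (T -> R)) (F : set T) : finite_set F ->
  exists B : set (T -> R), [/\ countable B, B `<=` P & forall f, P f ->
    forall e, 0 < e -> exists2 b, B b & forall t, F t -> `|f t - b t| < e].
Proof.
move=> /finite_seqP[s ->]; elim: s P => [|a s IHs] P.
  (* Any member of P will do on the empty set, but one is needed. *)
  have [->|/set0P[f Pf]] := eqVneq P set0; first by exists set0; split.
  exists [set f]; split; [exact: countable1|by move=> _ ->|].
  by move=> g _ e e0; exists f.
have /choice[B BP] : forall q : rat * rat, exists B : set (T -> R),
    [/\ countable B, B `<=` P `&` [set f | ratr q.1 < f a < ratr q.2] &
    forall f, (P `&` [set f | ratr q.1 < f a < ratr q.2]) f ->
      forall e, 0 < e -> exists2 b, B b &
      forall t, t \in s -> `|f t - b t| < e] by move=> q; exact: IHs.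
exists (\bigcup_q B q); split.
- by apply: bigcup_countable => [|q _]; [exact: countableP|have [] := BP q].
- by move=> b [q _]; have [_ BPq _] := BP q; move=> /BPq[].
move=> f Pf e e0.
have [q1] : exists q : rat, ratr q \in `]f a - e / 2, f a[.
  by apply: rat_in_itvoo; rewrite ltrBlDr ltrDl divr_gt0.
rewrite in_itv /= => /andP[q1l q1r].
have [q2] : exists q : rat, ratr q \in `]f a, f a + e / 2[.
  by apply: rat_in_itvoo; rewrite ltrDl divr_gt0.
rewrite in_itv /= => /andP[q2l q2r].
have [_ BPq dense_q] := BP (q1, q2).
have [|b Bb bf] := dense_q f _ e e0; first by split=> //=; rewrite q1r q2l.
exists b => [|t /=]; first by exists (q1, q2).
rewrite inE => /orP[/eqP ->|]; last exact: bf.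
have [_ /= /andP[bl br]] := BPq _ Bb.
rewrite [e]splitr ltr_distl; apply/andP; split.
  rewrite ltrBlDr (lt_le_trans br)// (le_trans (ltW q2r))// lerD2l.
  by rewrite lerDl divr_ge0 // ltW.
rewrite -ltrBlDr; apply: le_lt_trans bl; apply: le_trans (ltW q1l).
by rewrite lerB// lerDl divr_ge0 // ltW.
Qed.

(** * Lindelöf spaces *)

(** Indexing the cover by points records, for each member of the countable
    subcover, the centre to which further data can be attached. *)
Lemma lindelof_countable_nbhs (T : topologicalType) (U : T -> set T) :
  lindelof_space T -> (forall x, nbhs x (U x)) ->
  exists2 D : set T, countable D & forall x, exists2 d, D d & U d x.
Proof.
move=> LT nbhsU; have [||C [CU cC Cx]] := LT (range (fun x => interior (U x))).
- by move=> _ [x _ <-]; exact: open_interior.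
- rewrite -subTset => x _; exists (interior (U x)); first by exists x.
  exact: nbhs_singleton (nbhs_interior (nbhsU x)).
have /choice[c cE] : forall V : C, exists x, val V = interior (U x).
  by move=> V; have [x _ <-] := CU _ (set_valP V); exists x.
exists (range c).
  apply: (@sub_countable _ _ _ [set: C]); first exact: card_image_le.
  by rewrite (eq_countable (card_setT _)).
move=> x; have [V CV Vx] : (\bigcup_(V in C) V) x by rewrite Cx.
exists (c (SigSub (mem_set CV))); first by exists (SigSub (mem_set CV)).
by apply: interior_subset; rewrite -cE.
Qed.

(** For each n, countably many balls of radius 1 / (n + 1) cover M, since their
    preimages cover T; the centres of all of them are dense. *)
Lemma lindelof_separable_image {R : realType} {T : topologicalType}
    {M : pseudoMetricType R} (f : T -> M) :
  lindelof_space T -> continuous f -> range f = setT -> separable_space M.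
Proof.
move=> LT cf fT.
have /choice[D DP] : forall n, exists D : set T, countable D /\
    forall x, exists2 d, D d & ball (f d) n.+1%:R^-1 (f x).
  move=> n; have [x|D cD DP] := @lindelof_countable_nbhs T
    (fun x => f @^-1` ball (f x) n.+1%:R^-1) LT; last by exists D.
  by apply: cf; apply: nbhsx_ballx; rewrite invr_gt0.
exists (\bigcup_n f @` D n).
  apply: bigcup_countable => // n _; have [cD _] := DP n.
  exact: sub_countable (card_image_le _ _) cD.
move=> O [m Om] openO; have /nbhs_ballP[e /= /ltr_add_invr[n]] :=
  open_nbhs_nbhs (conj openO Om).
rewrite add0r => ne eO; have [x _ fxm] : range f m by rewrite fT.
have [_ /(_ x)[d Dd dx]] := DP n; exists (f d); split; last by exists n => //; exists d.
by apply: eO; apply: le_ball (ltW ne) _ _; rewrite -fxm; exact: ball_sym.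
Qed.

(** * Continuous functions on Tychonoff spaces *)

(** The function f + u * (g - f) works for any continuous u that is 0 on F and 1
    on K, and such a u is the product, over the points a of F, of functions that
    are 0 at a and 1 on K. *)
Lemma tychonoff_glue {R : realType} {T : topologicalType} (F K : set T)
    (f g : T -> R) : tychonoff_space T -> finite_set F -> finite_set K ->
  F `&` K = set0 -> continuous f -> continuous g ->
  exists h : T -> R, [/\ continuous h, (forall t, F t -> h t = f t) &
                         (forall t, K t -> h t = g t)].
Proof.
move=> [crT hT] /finite_seqP[s ->] finK sK cf cg.
have closedK : closed K.
  by have [+ _] := @accessible_finite_set_closed T; apply=> //; exact: hausdorff_accessible.
suff [u [cu us uK]] : exists u : T -> R, [/\ continuous u,
    (forall t, t \in s -> u t = 0) & (forall t, K t -> u t = 1)].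
  exists (fun t => f t + u t * (g t - f t)); split=> [t|t /= ts|t Kt].
  - apply: cvgD; first exact: cf.
    by apply: cvgM; [exact: cu|apply: cvgB; [exact: cg|exact: cf]].
  - by rewrite us// mul0r addr0.
  - by rewrite uK// mul1r addrC subrK.
elim: s sK => [|a s IHs] sK.
  by exists (fun=> 1); split=> // t; exact: cvg_cst.
have [|u [cu us uK]] := IHs.
  rewrite -subset0 -sK => t [ts Kt]; split=> //=.
  by rewrite inE ts orbT.
have nKa : ~ K a.
  by move=> Ka; suff: set0 a by []; rewrite -sK; split=> //=; rewrite inE eqxx.
have /(@uniform_separatorP _ R)[v [cv _ v0 v1]] := crT _ _ closedK nKa.
exists (fun t => v t * u t); split=> [t|t|t Kt].
- by apply: cvgM; [exact: cv|exact: cu].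
- rewrite inE => /orP[/eqP ->|/us ->]; last by rewrite mulr0.
  by rewrite (_ : v a = 0) ?mul0r//; apply: v0; exists a.
- by rewrite uK// mulr1; apply: v1; exists t.
Qed.

(** * The space of continuous functions with pointwise convergence *)

(** The finite boxes around f generate a filter; if it converges to f, then every
    neighbourhood of f contains a box.  Pointwise convergence is checked one
    coordinate at a time. *)
Lemma nbhs_ptws_finite (R : realType) (T : topologicalType)
    (f : {ptws T -> R}) (W : set {ptws T -> R}) : nbhs f W ->
  exists (F : set T) (e : R), [/\ finite_set F, 0 < e &
    forall g : {ptws T -> R}, (forall t, F t -> `|f t - g t| < e) -> W g].
Proof.
pose box (p : set T * R) :=
  [set g : {ptws T -> R} | forall t, p.1 t -> `|f t - g t| < p.2].
pose G := filter_from [set p | finite_set p.1 /\ 0 < p.2] box.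
have FG : Filter G.
  apply: filter_from_filter; first by exists (set0, 1) => /=.
  move=> [F e] [K d] [/= finF e0] [/= finK d0].
  exists (F `|` K, Num.min e d) => /=.
    by rewrite lt_min e0 d0 finite_setU.
  by move=> g gFK; split=> t /= Ft;
     (have /gFK : (F `|` K) t by [left|right]); rewrite lt_min => /andP[].
have Gf : {ptws, G --> f}.
  apply/pointwise_cvgP => t; apply/cvgrPdist_lt => e e0.
  exists ([set t], e); first by split=> //=; exact: finite_set1.
  by move=> g /(_ t erefl).
by move=> /Gf[[F e] [/= ? ?] FW]; exists F, e; split.
Qed.

(** C_p(T), the space of continuous real functions with the topology of pointwise
    convergence. *)
Definition Cp (R : realType) (T : topologicalType) :=
  set_type [set f : {ptws T -> R} | continuous (f : T -> R)].

Section Cp.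
Context (R : realType) (T : topologicalType).

HB.instance Definition _ := Topological.on (Cp R T).

Definition Cp_fun (y : Cp R T) : T -> R := val y.
Coercion Cp_fun : Cp >-> Funclass.

Lemma Cp_continuous (y : Cp R T) : continuous y.
Proof. exact: (set_valP y). Qed.

Definition Cp_of (f : T -> R) (cf : continuous f) : Cp R T :=
  SigSub (mem_set (cf : [set f : {ptws T -> R} | continuous (f : T -> R)] f)).

Lemma nbhs_Cp_finite (y : Cp R T) (W : set (Cp R T)) : nbhs y W ->
  exists (F : set T) (e : R), [/\ finite_set F, 0 < e &
    forall g : Cp R T, (forall t, F t -> `|y t - g t| < e) -> W g].
Proof.
move=> [_ [[V openV <-] Vy] VW].
have [F [e [finF e0 FV]]] := @nbhs_ptws_finite R T (val y) V (open_nbhs_nbhs (conj openV Vy)).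
by exists F, e; split=> // g yg; apply: VW; exact: FV.
Qed.

Lemma evaluation_separately_continuous :
  separately_continuous (fun p : T * Cp R T => p.2 p.1).
Proof.
split=> [t|y]; last exact: Cp_continuous.
move=> y; apply: (@cvg_comp _ _ _ set_val (fun f : {ptws T -> R} => f t)).
  exact: initial_continuous.
by have /pointwise_cvgP := @cvg_id _ (nbhs (val y : {ptws T -> R})); apply.
Qed.

End Cp.

Lemma tychonoff_separates {R : realType} {T : topologicalType} (x x' : T) :
  tychonoff_space T -> x <> x' -> exists y : Cp R T, y x <> y x'.
Proof.
move=> [crT hT] xx'.
have closed_x' : closed [set x'].
  exact: accessible_closed_set1 (hausdorff_accessible hT) x'.
have /(@uniform_separatorP _ R)[v [cv _ v0 v1]] := crT _ _ closed_x' xx'.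
exists (Cp_of _ _ _ cv) => /= vxx'.
have : v x = v x' by [].
rewrite (_ : v x = 0); last by apply: v0; exists x.
by rewrite (_ : v x' = 1); [move/esym/eqP; rewrite oner_eq0|apply: v1; exists x'].
Qed.

(** * Continuous functions on products with C_p *)

Lemma continuous_separately {T U V : topologicalType} (f : T * U -> V) :
  continuous f -> separately_continuous f.
Proof.
move=> cf; split=> [x y|y x].
  apply: (@continuous_comp _ _ _ (fun y => (x, y)) f); last exact: cf.
  by apply: cvg_pair; [exact: cvg_cst|exact: cvg_id].
apply: (@continuous_comp _ _ _ (fun x => (x, y)) f); last exact: cf.
by apply: cvg_pair; [exact: cvg_id|exact: cvg_cst].
Qed.

Lemma continuous_precomp_fst {S T U V : topologicalType} (i : S -> T)
    (f : T * U -> V) : continuous i -> continuous f ->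
  continuous (fun p : S * U => f (i p.1, p.2)).
Proof.
move=> ci cf p.
apply: (@continuous_comp _ _ _ (fun p : S * U => (i p.1, p.2)) f); last exact: cf.
apply: cvg_pair; last exact: cvg_snd.
by apply: cvg_comp; [exact: cvg_fst|exact: ci].
Qed.

(** Joint continuity gives, around each x and for each precision, a box in which
    g is almost constant, and whose second side restrains finitely many points.
    By the Lindelöf property countably many boxes serve all x for one precision,
    and the precisions 1 / (n + 1) suffice. *)
Lemma countable_support {R : realType} {L T : topologicalType}
    (g : L * Cp R T -> R) (b : Cp R T) : lindelof_space L -> continuous g ->
  exists2 A : set T, countable A & forall x e, 0 < e ->
    exists (F : set T) (d : R), [/\ finite_set F, F `<=` A, 0 < d &
      forall y : Cp R T, (forall t, F t -> `|b t - y t| < d) ->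
        `|g (x, b) - g (x, y)| < e].
Proof.
move=> LL cg.
have loc (nx : nat * L) : exists UFd : set L * set T * R,
    [/\ nbhs nx.2 UFd.1.1, finite_set UFd.1.2, 0 < UFd.2 &
     forall x (y : Cp R T), UFd.1.1 x -> (forall t, UFd.1.2 t -> `|b t - y t| < UFd.2) ->
      `|g (nx.2, b) - g (x, y)| < nx.1.+1%:R^-1 / 2].
  case: nx => n x /=.
  have n0 : 0 < n.+1%:R^-1 / 2 :> R by rewrite divr_gt0 ?invr_gt0.
  have /cvgrPdist_lt/(_ _ n0)[[U V] /= [nbU nbV] UV] := cg (x, b).
  have [F [d [finF d0 FV]]] := nbhs_Cp_finite _ _ _ _ nbV.
  exists (U, F, d); split=> //= x' y Ux' yF.
  by apply: (UV (x', y)); split=> //=; exact: FV.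
have {loc}/choice[c cP] := loc.
have /choice[D DP] : forall n, exists D : set L, countable D /\
    forall x, exists2 d, D d & (c (n, d)).1.1 x.
  move=> n; have [x|D] := @lindelof_countable_nbhs L
    (fun x => (c (n, x)).1.1) LL; last by exists D.
  by have [] := cP (n, x).
exists (\bigcup_n \bigcup_(x in D n) (c (n, x)).1.2).
  apply: bigcup_countable => // n _; apply: bigcup_countable.
    by have [] := DP n.
  by move=> x _; apply: finite_set_countable; have [] := cP (n, x).
move=> x e /ltr_add_invr[n]; rewrite add0r => ne.
have [_ /(_ x)[z Dz zx]] := DP n; have [_ finF d0 gP] := cP (n, z).
exists (c (n, z)).1.2, (c (n, z)).2; split=> //.
  by move=> t Ft; exists n => //; exists z.
move=> y yF; apply: lt_trans ne; rewrite [ltRHS]splitr.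
rewrite (le_lt_trans (ler_distD (g (z, b)) _ _))// ltrD//; last exact: gP.
by rewrite distrC; apply: gP => // t _; rewrite subrr normr0.
Qed.

(** All sections y of evaluation together separate the points of Z.  Passing to
    the approximations f_n trades the separately continuous map for jointly
    continuous ones, and for these countably many sections f_n(., b) suffice on X:
    a section f_n(., y) that separates x from x' can be replaced by some
    f_n(., b), through a y' that is close to y and to b on the finitely many
    points of Z that matter for each. *)
Lemma first_Baire_separating_family (R : realType) (Z : topologicalType)
    (X : set Z) : tychonoff_space Z -> lindelof_space X ->
    first_Baire_class (fun p : Z * Cp R Z => p.2 p.1) ->
  exists G : set (X -> R), [/\ countable G, (forall g, G g -> continuous g) &
    forall x x', (forall g, G g -> g x = g x') -> x = x'].
Proof.
move=> tZ lX [f_ [cf f_cvg]].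
pose fX n (p : X * Cp R Z) := f_ n (val p.1, p.2).
have cfX n : continuous (fX n).
  by apply: continuous_precomp_fst (cf n) => x; exact: initial_continuous.
have sfX n : separately_continuous (fX n) := continuous_separately _ (cfX n).
have /choice[supp suppP] : forall nb : nat * Cp R Z, exists A : set Z,
    countable A /\ forall x e, 0 < e ->
    exists (F : set Z) (d : R), [/\ finite_set F, F `<=` A, 0 < d &
      forall y : Cp R Z, (forall t, F t -> `|nb.2 t - y t| < d) ->
        `|fX nb.1 (x, nb.2) - fX nb.1 (x, y)| < e].
  by case=> n b; have [A] := countable_support (fX n) b lX (cfX n); exists A.
have /choice[den denP] : forall F : set Z, exists B : set (Cp R Z),
    finite_set F -> countable B /\ forall y : Cp R Z, forall e, 0 < e ->
      exists2 b, B b & forall t, F t -> `|y t - b t| < e.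
  move=> F; have [finF|] := pselect (finite_set F); last by exists set0.
  have [B [cB BC Bd]] := countable_dense_on_finite
    [set f : Z -> R | continuous f] F finF.
  have /choice[h hP] : forall f : B, exists y : Cp R Z, val y = val f.
    by move=> f; exists (Cp_of _ _ _ (BC _ (set_valP f))).
  exists (range h) => _; split.
    apply: (@sub_countable _ _ _ [set: B]); first exact: card_image_le.
    by rewrite (eq_countable (card_setT _)).
  move=> y e e0; have [b Bb by_] := Bd y (Cp_continuous _ _ y) e e0.
  exists (h (SigSub (mem_set Bb))); first by exists (SigSub (mem_set Bb)).
  by move=> t Ft; rewrite /Cp_fun hP; exact: by_.
(* A is closed under passing from a finite set F to the points that control the
   f_n near the functions approximating on F. *)
have [|A cA AP] := @countable_closure Z
  (fun F => \bigcup_n \bigcup_(b in den F) supp (n, b)).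
  move=> F /denP[cF _]; apply: bigcup_countable => // n _.
  by apply: bigcup_countable => // b _; have [] := suppP (n, b).
pose B := \bigcup_(F in [set F | F `<=` A /\ finite_set F]) den F.
have cB : countable B.
  apply: bigcup_countable; first exact: countable_finite_subset.
  by move=> F [_ /denP[]].
exists (\bigcup_n \bigcup_(b in B) [set (fun x => fX n (x, b))]); split.
- apply: bigcup_countable => // n _; apply: bigcup_countable => // b _.
- by move=> _ [n _ [b _ ->]]; have [_] := sfX n; apply.
move=> x x' Gxx'; apply: contrapT => xx'.
have [|y] := @tychonoff_separates R Z (val x) (val x') tZ.
  by move/val_inj.
apply.
have fxx' n : f_ n (val x, y) = f_ n (val x', y).
  apply: contrapT => /eqP; rewrite -subr_eq0 -normr_gt0 => c0.
  set c := `|_| in c0; have c40 : 0 < c / 4 by rewrite divr_gt0.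
  (* Going from y to b through y', at x and at x', costs four errors. *)
  have near_y (z : X) : nbhs y [set y' | `|fX n (z, y) - fX n (z, y')| < c / 4].
    by have [/(_ z y)/cvgrPdist_lt + _] := sfX n; apply.
  have [K [e [finK e0 KW]]] := nbhs_Cp_finite _ _ _ _ (filterI (near_y x) (near_y x')).
  have finKA : finite_set (K `&` A) by exact: finite_setIl.
  have [_ /(_ y e e0)[b denb by_]] := denP _ finKA.
  have suppA m : supp (m, b) `<=` A.
    move=> t tb; apply: (AP (K `&` A)) => //.
    by exists m => //; exists b.
  have Bb : B b by exists (K `&` A) => //; split=> // ? [].
  have [_ bP] := suppP (n, b).
  have [F [d [finF FA d0 Fb]]] := bP x _ c40.
  have [F' [d' [finF' FA' d0' Fb']]] := bP x' _ c40.
  (* The points of K outside A are disjoint from those that control b, so the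
     two requirements on y' are compatible. *)
  have [|||||h [ch h1 h2]] := @tychonoff_glue R Z (K `&` A `|` (F `|` F')) (K `\` A) b y tZ.
  - by rewrite !finite_setU.
  - exact: finite_setD.
  - rewrite -subset0 => t [+ [_ nAt]]; case=> [[_]//|[/FA|/FA']].
    + by move=> /suppA.
    + by move=> /suppA.
  - exact: Cp_continuous.
  - exact: Cp_continuous.
  pose y' := Cp_of _ _ h ch.
  have [yx yx'] : [set y' | `|fX n (x, y) - fX n (x, y')| < c / 4] y' /\
      [set y' | `|fX n (x', y) - fX n (x', y')| < c / 4] y'.
    apply: KW => t Kt; have [At|nAt] := pselect (A t).
      by rewrite [y' t]h1; [exact: by_|left].
    by rewrite [y' t]h2 ?subrr ?normr0.
  have bx : `|fX n (x, b) - fX n (x, y')| < c / 4.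
    by apply: Fb => t Ft; rewrite [y' t]h1 ?subrr ?normr0//; right; left.
  have bx' : `|fX n (x', b) - fX n (x', y')| < c / 4.
    by apply: Fb' => t Ft; rewrite [y' t]h1 ?subrr ?normr0//; right; right.
  have bxx' : fX n (x, b) = fX n (x', b).
    by apply: (Gxx' (fun x => fX n (x, b))); exists n => //; exists b.
  suff : `|fX n (x, y) - fX n (x', y)| < c by rewrite ltxx.
  move: yx yx' bx bx' bxx'; rewrite /= !ltr_norml; clearbody c => {c0 c40 Fb Fb' KW}.
  move=> /andP[? ?] /andP[? ?] /andP[? ?] /andP[? ?] ?; apply/andP; split; lra.
apply: (@cvg_unique _ (@Rhausdorff R) _ _ (y (val x)) (y (val x')) (f_cvg (val x, y))).
have -> : (fun n => f_ n (val x, y)) = (fun n => f_ n (val x', y)).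
  exact/funext.
exact: f_cvg.
Qed.

(** * Coarser separable metric topologies *)

(** A copy of T for the metric sup_k min(|phi_k x - phi_k y|, 1 / (k + 1)).  The
    proof of separation is a parameter because without it there is only a
    pseudometric. *)
Definition separated_by {R : realType} {T : choiceType} (phi : nat -> T -> R)
  (sep : forall x y, (forall k, phi k x = phi k y) -> x = y) : Type := T.

Section separated_by.
Context {R : realType} {T : choiceType} (phi : nat -> T -> R).
Context (sep : forall x y, (forall k, phi k x = phi k y) -> x = y).

Local Notation M := (separated_by phi sep).

Let term (x y : M) k : R := Num.min `|phi k x - phi k y| k.+1%:R^-1.

Definition sep_dist (x y : M) : R := sup (range (term x y)).

Let term_le1 x y k : term x y k <= 1.
Proof. by rewrite ge_min invf_le1 ?ler1n ?orbT. Qed.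

Let term_le_dist x y k : term x y k <= sep_dist x y.
Proof.
apply: ub_le_sup; last by exists k.
by exists 1 => _ [n _ <-].
Qed.

Lemma sep_dist_le x y e :
  (forall k, `|phi k x - phi k y| <= e \/ k.+1%:R^-1 <= e) -> sep_dist x y <= e.
Proof.
move=> te; apply: ge_sup; first by exists (term x y 0), 0%N.
by move=> _ [n _ <-]; rewrite ge_min; have [->|->] := te n; rewrite ?orbT.
Qed.

Let sep_distxx x : sep_dist x x = 0.
Proof.
apply/le_anti/andP; split.
  by apply: sep_dist_le => k; left; rewrite subrr normr0.
by apply: le_trans (term_le_dist x x 0); rewrite le_min normr_ge0 invr_ge0 ler0n.
Qed.

Let sep_dist_positivity x y : sep_dist x y = 0 -> x = y.
Proof.
move=> xy0; apply: sep => k; apply/eqP; rewrite -subr_eq0 -normr_le0.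
have := term_le_dist x y k; rewrite xy0 ge_min => /orP[//|].
by rewrite invr_le0 leNgt ltr0n.
Qed.

Let sep_dist_sym x y : sep_dist x y = sep_dist y x.
Proof.
rewrite /sep_dist (_ : term x y = term y x)//.
by apply/funext => k; rewrite /term distrC.
Qed.

Let sep_dist_triangle y x z : sep_dist x z <= sep_dist x y + sep_dist y z.
Proof.
apply: ge_sup; first by exists (term x z 0), 0%N.
move=> _ [k _ <-]; apply: (le_trans _ (lerD (term_le_dist x y k) (term_le_dist y z k))).
rewrite /term; set r := k.+1%:R^-1; have r0 : 0 <= r by rewrite invr_ge0 ler0n.
have xyz := ler_distD (phi k y) (phi k x) (phi k z).
have := normr_ge0 (phi k x - phi k y); have := normr_ge0 (phi k y - phi k z).
rewrite ge_min !minElt => ? ?; apply/orP.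
by case: ltP => ?; case: ltP => ?; [left|right|right|right]; lra.
Qed.

HB.instance Definition _ := Choice.on M.
HB.instance Definition _ := isMetric.Build R M
  sep_distxx sep_dist_positivity sep_dist_sym sep_dist_triangle.

End separated_by.

(** The caps 1 / (k + 1) make all but finitely many terms of the supremum small,
    whatever the point y is. *)
Lemma separated_by_continuous {R : realType} {T : topologicalType}
    (phi : nat -> T -> R) sep : (forall k, continuous (phi k)) ->
  continuous (id : T -> separated_by phi sep).
Proof.
move=> cphi x A /nbhs_ballP[e /= e0 eA].
have e20 : 0 < e / 2 by rewrite divr_gt0.
have /ltr_add_invr[n] := e20; rewrite add0r => ne.
have : \forall y \near x, forall k : 'I_n, `|phi k x - phi k y| < e / 2.
  by apply: filter_forall => k; have /cvgrPdist_lt := cphi k x; apply.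
apply: filterS => y xy; apply: eA; rewrite ballEmdist /=.
apply: (@le_lt_trans _ _ (e / 2)); last by rewrite ltr_pdivrMr// ltr_pMr// ltr1n.
apply: sep_dist_le => k; have [kn|nk] := ltnP k n.
  by left; exact: ltW (xy (Ordinal kn)).
right; apply: le_trans (ltW ne); rewrite lef_pV2 ?posrE//.
by rewrite ler_nat ltnS.
Qed.

Lemma lindelof_condensation {R : realType} {T : topologicalType}
    (G : set (T -> R)) : lindelof_space T -> countable G ->
    (forall g, G g -> continuous g) ->
    (forall x y, (forall g, G g -> g x = g y) -> x = y) ->
  exists (H : topologicalType) (phi : T -> H),
    [/\ separable_space H, metrizable_space R H,
        continuous phi & bijective phi].
Proof.
move=> LT cG ctsG sepG.
have [phi [cphi sep]] : exists phi : nat -> T -> R, (forall k, continuous (phi k)) /\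
    forall x y, (forall k, phi k x = phi k y) -> x = y.
  have /pfcard_geP[G0|[phi]] := cG.
    exists (fun _ _ => 0); split=> [k x|x y _]; first exact: cvg_cst.
    by apply: sepG => g; rewrite G0.
  exists phi; split=> [k|x y xy]; first by apply: ctsG; exact: funS.
  by apply: sepG => g /(surj (f:=phi))[k _ <-]; exact: xy.
have cid := separated_by_continuous phi sep cphi.
exists (separated_by phi sep), id; split=> //.
- by apply: (lindelof_separable_image _ LT cid); rewrite eqEsubset; split=> // x; exists x.
- by exists (separated_by phi sep), id, id; split=> // x; exact: cvg_id.
- by exists id.
Qed.

(** * Lindelöf subspaces of spaces with the B-property *)

(* As a type, [X] carries the subspace topology. *)
Theorem theorem4p2 (R : realType) (Z : topologicalType) (X : set Z)
    (tychonoffZ : tychonoff_space Z) (BZ : B_property R Z)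
    (lindelofX : lindelof_space X) :
  exists (H : topologicalType) (phi : X -> H),
    [/\ separable_space H, metrizable_space R H,
        continuous phi & bijective phi].
Proof.
have f1 := BZ _ _ (evaluation_separately_continuous R Z).
have [G [cG ctsG sepG]] := first_Baire_separating_family _ _ _ tychonoffZ lindelofX f1.
exact: lindelof_condensation lindelofX cG ctsG sepG.
Qed.
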